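(* Let $A\subseteq\mathcal{R}$ be S-measurable. Then $A$ can be written as a disjoint union $A=\left(\bigcup_{n=1}^\infty K_n\right)\cup S$, where each $K_n$ is an interval in $\mathcal{R}$, the $K_n$ are pairwise disjoint, $\sum_{n=1}^\infty l(K_n)$ converges in $\mathcal{R}$ with $\sum_{n=1}^\infty l(K_n)=M_s(A)$, and $S$ is S-measurable with $M_s(S)=0$.
   Context: The Levi-Civita field $\mathcal{R}$ is the set of functions $x:\mathbb{Q}\to\mathbb{R}$ with left-finite support (for every $q\in\mathbb{Q}$ only finitely many points of the support are smaller than $q$), with componentwise addition and formal power series (Cauchy product) multiplication. It is an ordered field extending $\mathbb{R}$, where $x>0$ iff $x\neq 0$ and $x[\min\operatorname{supp}(x)]>0$. Limits and infinite sums in $\mathcal{R}$ are taken in the order topology, in which $\mathcal{R}$ is Cauchy complete; a series $\sum a_n$ converges iff $a_n\to 0$. An interval is a set of the form $[a,b],[a,b),(a,b]$ or $(a,b)$ with $a<b$ in $\mathcal{R}$; its length is $l=b-a$. A set $A\subseteq\mathcal{R}$ is S-measurable if for every $\epsilon>0$ in $\mathcal{R}$ there are sequences of pairwise disjoint intervals $(I_n)$ and $(J_n)$ with $\bigcup_n I_n\subseteq A\subseteq\bigcup_n J_n$, both $\sum_n l(I_n)$ and $\sum_n l(J_n)$ convergent in $\mathcal{R}$, and $\sum_n l(J_n)-\sum_n l(I_n)\le\epsilon$. For such $A$, the S-measure $M_s(A)$ is the common value of $\lim_{k\to\infty}\sum_n l(I^k_n)=\lim_{k\to\infty}\sum_n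 l(J^k_n)$ for any such inner/outer sequences with gap at most $d^k$, where $d\in\mathcal{R}$ is given by $d[1]=1$ and $d[t]=0$ for $t\neq 1$; equivalently $M_s(A)$ is both the supremum of $\sum l(I_n)$ over inner disjoint interval families and the infimum of $\sum l(J_n)$ over outer ones. *)

(* Defs.v *)
(* the Levi-Civita field is modelled concretely as functions
   rat -> R (R = Stdlib reals, a realType via Rstruct) with left-finite support. *)
From HB Require Import structures.
From mathcomp Require Import all_boot all_order all_algebra.
From mathcomp Require Import Rstruct.
Set Implicit Arguments. Unset Strict Implicit. Unset Printing Implicit Defensive.
Import Order.TTheory GRing.Theory Num.Theory.
Local Open Scope ring_scope.

Notation Rr := Rdefinitions.R.

Definition LCfun := rat -> Rr.

Definition leftfinite (x : LCfun) : Prop :=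
  forall q : rat, exists s : seq rat, forall t : rat, x t != 0 -> t < q -> t \in s.

Definition LC (x : LCfun) : Prop := leftfinite x.

Definition lc0 : LCfun := fun _ => 0.
Definition lcadd (x y : LCfun) : LCfun := fun t => x t + y t.
Definition lcopp (x : LCfun) : LCfun := fun t => - x t.
Definition lcsub (x y : LCfun) : LCfun := fun t => x t - y t.

Definition lcpos (x : LCfun) : Prop :=
  exists t : rat, 0 < x t /\ forall s : rat, s < t -> x s = 0.

Definition lclt (x y : LCfun) : Prop := lcpos (lcsub y x).
Definition lcle (x y : LCfun) : Prop := lclt x y \/ x = y.

Inductive ikind := CC | CO | OC | OO.

Record interval := Itv { ilo : LCfun; ihi : LCfun; ikd : ikind }.

Definition valid_itv (I : interval) : Prop :=
  LC (ilo I) /\ LC (ihi I) /\ lclt (ilo I) (ihi I).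

Definition in_itv (I : interval) (x : LCfun) : Prop :=
  LC x /\
  match ikd I with
  | CC => lcle (ilo I) x /\ lcle x (ihi I)
  | CO => lcle (ilo I) x /\ lclt x (ihi I)
  | OC => lclt (ilo I) x /\ lcle x (ihi I)
  | OO => lclt (ilo I) x /\ lclt x (ihi I)
  end.

Definition itv_len (I : interval) : LCfun := lcsub (ihi I) (ilo I).

(** A (possibly finite, possibly empty) sequence of intervals:
    [None] entries are absent terms. *)
Definition itv_family := nat -> option interval.

Definition fam_valid (F : itv_family) : Prop :=
  forall n I, F n = Some I -> valid_itv I.

Definition fam_disjoint (F : itv_family) : Prop :=
  forall m n I J x, m <> n -> F m = Some I -> F n = Some J ->
    in_itv I x -> in_itv J x -> False.

Definition fam_union (F : itv_family) (x : LCfun) : Prop :=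
  exists n I, F n = Some I /\ in_itv I x.

Definition fam_len (F : itv_family) (n : nat) : LCfun :=
  match F n with Some it => itv_len it | None => lc0 end.

Fixpoint psum (f : nat -> LCfun) (N : nat) : LCfun :=
  match N with
  | O => lc0
  | N'.+1 => lcadd (psum f N') (f N')
  end.

Definition lc_lim_to (u : nat -> LCfun) (L : LCfun) : Prop :=
  LC L /\
  forall eps : LCfun, LC eps -> lcpos eps ->
    exists N : nat, forall m : nat, (N <= m)%N ->
      lclt (lcsub (u m) L) eps /\ lclt (lcsub L (u m)) eps.

Definition fam_sum_to (F : itv_family) (L : LCfun) : Prop :=
  lc_lim_to (psum (fam_len F)) L.

Definition subset (A B : LCfun -> Prop) : Prop := forall x, A x -> B x.

Definition inner_sum (A : LCfun -> Prop) (s : LCfun) : Prop :=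
  exists I : itv_family, fam_valid I /\ fam_disjoint I /\
    subset (fam_union I) A /\ fam_sum_to I s.

Definition outer_sum (A : LCfun -> Prop) (s : LCfun) : Prop :=
  exists J : itv_family, fam_valid J /\ fam_disjoint J /\
    subset A (fam_union J) /\ fam_sum_to J s.

Definition Smeasurable (A : LCfun -> Prop) : Prop :=
  forall eps : LCfun, LC eps -> lcpos eps ->
    exists sI sJ : LCfun, inner_sum A sI /\ outer_sum A sJ /\
      lcle (lcsub sJ sI) eps.

Definition is_sup (P : LCfun -> Prop) (m : LCfun) : Prop :=
  LC m /\ (forall s, P s -> lcle s m) /\
  (forall u, LC u -> (forall s, P s -> lcle s u) -> lcle m u).

Definition is_inf (P : LCfun -> Prop) (m : LCfun) : Prop :=
  LC m /\ (forall s, P s -> lcle m s) /\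
  (forall u, LC u -> (forall s, P s -> lcle u s) -> lcle u m).

Definition Smeasure_is (A : LCfun -> Prop) (m : LCfun) : Prop :=
  is_sup (inner_sum A) m /\ is_inf (outer_sum A) m.

(* Main.v *)
(* Approximate A from inside, with error d^k, by a finite disjoint list F_k of half-open intervals (endpoints are shifted by infinitely small amounts), and disjointify: the K_n are the pieces of F_k minus F_0, ..., F_(k-1). Working with finite lists matters: the difference of two finite unions of half-open intervals is again one, whereas an interval minus infinitely many intervals need not be a union of intervals. The lengths of the pieces tend to 0, hence their sum converges, and its limit is M_s(A). An outer family (J_n) of A with small gap, minus the finitely many pieces built up to stage k, covers the rest S with arbitrarily small total length.

The inequality behind all this is that a finite disjoint list of intervals covered by a sequence (J_n) is not longer than the sum of the lengths of the J_n; this rests on the uncountability of the reals, see slen_le_cover. *)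

Require Import Defs.
From HB Require Import structures.
From mathcomp Require Import all_boot all_order all_algebra.
From mathcomp Require Import Rstruct.
From mathcomp Require Import boolp lra.
Set Implicit Arguments. Unset Strict Implicit. Unset Printing Implicit Defensive.
Import Order.TTheory GRing.Theory Num.Theory.
Local Open Scope ring_scope.

(** Nested intervals: the n-th step shrinks the current interval so that [u n] falls strictly
    outside, and the supremum of the left ends lies in all of them. *)
Lemma real_interval_uncountable (u : nat -> Rr) (a b : Rr) :
  a < b -> exists x, a <= x <= b /\ forall n, u n != x.
Proof.
move=> ab.
(* Since [u n] may equal the midpoint, the second case keeps only the first quarter; this makes the
   exclusion strict. *)
pose step n (I : Rr * Rr) : Rr * Rr := let m := (I.1 + I.2) / 2 in
  if u n < m then (m, I.2) else (I.1, (I.1 + m) / 2).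
pose I := fix I n := if n is n'.+1 then step n' (I n') else (a, b).
have lt_I n : (I n).1 < (I n).2.
  elim: n => //= n; rewrite /step; case: (ltP (u n) _) => _ /=; lra.
have stepP n : [/\ (I n).1 <= (I n.+1).1, (I n.+1).2 <= (I n).2 &
    (u n < (I n.+1).1) || ((I n.+1).2 < u n)].
  have := lt_I n; rewrite /= /step; case: (ltP (u n) _) => /= h hI; split=> //; lra.
have mono (m n : nat) : (m <= n)%N -> (I m).1 <= (I n).1 /\ (I n).2 <= (I m).2.
  move=> /subnKC <-; elim: (n - m)%N => [|k [h1 h2]]; first by rewrite addn0.
  by rewrite addnS; have [h3 h4 _] := stepP (m + k)%N; split; lra.
have sep (m n : nat) : (I m).1 < (I n).2.
  have [h1 h2] := mono _ _ (leq_maxl m n); have [h3 h4] := mono _ _ (leq_maxr m n).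
  by have := lt_I (maxn m n); lra.
pose E x := exists n, x = (I n).1.
have [|| x [ubx lubx]] := Raxioms.completeness E.
- by exists b => _ [n ->]; apply/RleP; have := sep n 0%N; rewrite /=; lra.
- by exists a, 0%N.
have lox n : (I n).1 <= x by apply/RleP/ubx; exists n.
have hix n : x <= (I n).2.
  by apply/RleP/lubx => _ [m ->]; apply/RleP/ltW.
exists x; split; first by rewrite (lox 0%N) (hix 0%N).
move=> n; apply/eqP => un; have [_ _] := stepP n.
by have := lox n.+1; have := hix n.+1; rewrite un => h1 h2 /orP[]; lra.
Qed.

(** * The ordered group of the Levi-Civita field *)

(** Bundling left-finiteness with the function lets group and order structures be attached; by proof
    irrelevance equality stays pointwise. *)
Record lc := MkLC { lcval :> rat -> Rr; lcvalP : LC lcval }.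

Lemma lc_inj (x y : lc) : (forall t, x t = y t) -> x = y.
Proof.
case: x y => [x hx] [y hy] /= /funext xy; move: hx hy; rewrite xy => hx hy.
by congr MkLC; exact: Prop_irrelevance.
Qed.

Lemma LC0 : LC lc0.
Proof. by move=> q; exists [::] => t; rewrite eqxx. Qed.

Lemma LCadd x y : LC x -> LC y -> LC (lcadd x y).
Proof.
move=> hx hy q; have [s hs] := hx q; have [s' hs'] := hy q.
exists (s ++ s') => t nz tq; rewrite mem_cat.
have [x0|nx] := eqVneq (x t) 0; last by rewrite hs.
by rewrite hs' ?orbT //; move: nz; rewrite /lcadd x0 add0r.
Qed.

Lemma LCopp x : LC x -> LC (lcopp x).
Proof.
by move=> hx q; have [s hs] := hx q; exists s => t; rewrite oppr_eq0; exact: hs.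
Qed.

Lemma LCmonomial r q : LC (fun t => if t == q then r else 0).
Proof.
move=> q'; exists [:: q] => t; rewrite inE; case: (t == q) => //.
by rewrite eqxx.
Qed.

HB.instance Definition _ := gen_eqMixin lc.
HB.instance Definition _ := gen_choiceMixin lc.

Definition lc_zero := MkLC LC0.
Definition lc_add (x y : lc) := MkLC (LCadd (lcvalP x) (lcvalP y)).
Definition lc_opp (x : lc) := MkLC (LCopp (lcvalP x)).

Lemma lc_addA : associative lc_add.
Proof. by move=> x y z; apply: lc_inj => t /=; rewrite /lcadd addrA. Qed.
Lemma lc_addC : commutative lc_add.
Proof. by move=> x y; apply: lc_inj => t /=; rewrite /lcadd addrC. Qed.
Lemma lc_add0 : left_id lc_zero lc_add.
Proof. by move=> x; apply: lc_inj => t /=; rewrite /lcadd /lc0 add0r. Qed.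
Lemma lc_addN : left_inverse lc_zero lc_opp lc_add.
Proof. by move=> x; apply: lc_inj => t /=; rewrite /lcadd /lc0 /lcopp addNr. Qed.

HB.instance Definition _ := GRing.isZmodule.Build lc lc_addA lc_addC lc_add0 lc_addN.

Lemma lcval0 t : (0 : lc) t = 0. Proof. by []. Qed.
Lemma lcvalD (x y : lc) t : (x + y) t = x t + y t. Proof. by []. Qed.
Lemma lcvalN (x : lc) t : (- x) t = - x t. Proof. by []. Qed.
Lemma lcvalB (x y : lc) t : (x - y) t = x t - y t. Proof. by []. Qed.
Definition lcvalE := (lcvalB, lcvalD, lcvalN, lcval0).

Lemma lcval_sum (I : Type) (s : seq I) (F : I -> lc) t :
  (\sum_(i <- s) F i) t = \sum_(i <- s) F i t.
Proof. by apply: (big_morph (fun x : lc => x t)). Qed.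

Definition monomial r q : lc := MkLC (LCmonomial r q).
Notation dq := (monomial 1).

Lemma monomialE r q t : monomial r q t = if t == q then r else 0.
Proof. by []. Qed.

Lemma lc_lead (x : lc) : x != 0 -> exists t, x t != 0 /\ forall s, s < t -> x s = 0.
Proof.
move=> nz; have [t0 xt0] : exists t, x t != 0.
  apply: contrapT => h; move/eqP: nz; apply; apply: lc_inj => t.
  by apply/eqP/negPn/negP => xt; apply: h; exists t.
(* The bound [t0 + 1] makes the list contain [t0]; its least support point is then least in the
   whole support. *)
have [s hs] := lcvalP x (t0 + 1).
pose s' := sort <=%O [seq t <- s | x t != 0].
have t0s : t0 \in s' by rewrite mem_sort mem_filter xt0 hs // ltrDl.
have : sorted <=%O s' by apply: sort_sorted => ? ?; exact: le_total.
case E : s' t0s => [//|t s''] t0s; rewrite /= (path_sortedE le_trans) => /andP[/allP tle _].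
have : t \in s' by rewrite E mem_head.
rewrite mem_sort mem_filter => /andP[xt ts]; exists t; split => // r rt.
apply/eqP/negPn/negP => xr.
have le_t u : u \in s' -> t <= u by rewrite E inE => /orP[/eqP->//|/tle].
have tt0 : t <= t0 by apply: le_t; rewrite E.
have : r \in s'.
  by rewrite mem_sort mem_filter xr hs // (lt_trans rt) // (le_lt_trans tt0) // ltrDl.
by move/le_t; rewrite leNgt rt.
Qed.

Definition lc_le (x y : lc) := `[< lcle x y >].

Lemma lclt_subP (x y : lc) : lclt x y <-> lcpos (y - x).
Proof. by []. Qed.

Lemma lcposD (x y : lc) : lcpos x -> lcpos y -> lcpos (x + y).
Proof.
move=> [t [xt x0]] [s [ys y0]]; case: (ltgtP t s) => ts.
- by exists t; rewrite lcvalE y0 // addr0; split => // r rt;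
    rewrite lcvalE x0 // y0 ?addr0 // (lt_trans rt).
- exists s; rewrite lcvalE x0 // add0r; split => // r rs.
  by rewrite lcvalE x0 ?y0 ?addr0 // (lt_trans rs).
- rewrite -ts in ys y0; exists t; rewrite lcvalE; split; first lra.
  by move=> r rt; rewrite lcvalE x0 // y0 // addr0.
Qed.

Lemma lcpos0 : ~ lcpos (0 : lc).
Proof. by move=> [t [/=]]; rewrite /lc0 ltxx. Qed.

Lemma lc_leP (x y : lc) : reflect (lclt x y \/ x = y) (lc_le x y).
Proof.
apply: (iffP (asboolP _)) => -[h|h]; [by left|right|by left|by right; rewrite h].
by apply: lc_inj => t; rewrite h.
Qed.

Fact lc_le_anti : antisymmetric lc_le.
Proof.
move=> x y /andP[/lc_leP[h|//] /lc_leP[h'|//]].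
have := @lcposD (y - x) (x - y) h h'; rewrite addrA subrK subrr.
by move/lcpos0.
Qed.

Fact lc_le_trans : transitive lc_le.
Proof.
move=> y x z /lc_leP[h|->//] /lc_leP[h'|<-]; apply/lc_leP; left => //.
have := @lcposD (z - y) (y - x) h' h; rewrite addrA subrK.
exact.
Qed.

Fact lc_le_total : total lc_le.
Proof.
move=> x y; have [->|] := eqVneq x y.
  by apply/orP; left; apply/lc_leP; right.
rewrite -subr_eq0 => /lc_lead[t []]; rewrite lcvalE => xy0 xyl.
apply/orP; have [h|h] := ltP (x t) (y t); [left|right]; apply/lc_leP; left; exists t.
  rewrite /lcsub subr_gt0; split => // s /xyl; rewrite lcvalE => /eqP.
  by rewrite subr_eq0 => /eqP->; rewrite subrr.
rewrite /lcsub subr_gt0; split; last by move=> s /xyl.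
by rewrite lt_neqAle h andbT -subr_eq0 -opprB oppr_eq0.
Qed.

HB.instance Definition _ := Order.isOrder.Build ring_display lc
  (fun _ _ => erefl) (fun _ _ => erefl) (fun _ _ => erefl)
  lc_le_anti lc_le_trans lc_le_total.

Lemma lcltE (x y : lc) : lclt x y <-> x < y.
Proof.
rewrite lt_neqAle; split => [h|/andP[n /lc_leP[//|/eqP]]]; last by rewrite (negbTE n).
apply/andP; split; last by apply/lc_leP; left.
apply/eqP => xy; move: h; rewrite xy lclt_subP subrr; exact: lcpos0.
Qed.

Lemma lcleE (x y : lc) : lcle x y <-> x <= y.
Proof. by split=> /asboolP. Qed.

Lemma lcposE (x : lc) : lcpos x <-> 0 < x.
Proof. by rewrite -lcltE lclt_subP subr0. Qed.

Lemma lc_subr_gt0 (x y : lc) : (0 < y - x) = (x < y).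
Proof. by apply/idP/idP; rewrite -lcltE -lcposE. Qed.

Lemma lc_subr_ge0 (x y : lc) : (0 <= y - x) = (x <= y).
Proof. by rewrite !le_eqVlt lc_subr_gt0 eq_sym subr_eq0 eq_sym. Qed.

(* The positivity functional reads off the coefficients at the leading exponents, each one weighted by a much smaller real number than the previous one. *)
Lemma lc_functional_leads (ts : seq rat) (l : seq lc) : sorted <%O ts ->
  (forall x, x \in l -> exists t, [/\ t \in ts, 0 < x t & forall s, s < t -> x s = 0]) ->
  exists f : {additive lc -> Rr}, forall x, x \in l -> 0 < f x.
Proof.
elim: ts l => [|t ts IH] l.
  move=> _ hl; case: l hl => [|x l] hl; first by exists \0.
  by have [t []] := hl x (mem_head _ _).
rewrite /= (path_sortedE lt_trans) => /andP[/allP tlt sts] hl.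
have [|f hf] := IH [seq x : lc <- l | x t == 0] sts.
  move=> x; rewrite mem_filter => /andP[/eqP xt /hl[s []]].
  rewrite inE => /orP[/eqP->|st xs x0]; last by exists s.
  by rewrite xt ltxx.
have hl' (x : lc) : x \in l -> x t != 0 -> 0 < x t.
  move=> /hl[s []]; rewrite inE => /orP[/eqP->//|/tlt ts' _ x0].
  by rewrite x0 ?eqxx.
(* The functional [f] is controlled only where the coefficient at [t] is zero. Elsewhere [f x] may
   be negative, and [e] is taken so small that [x t] wins. *)
have [e [e0 he]] : exists e : Rr, 0 < e /\
    forall x : lc, x \in l -> x t != 0 -> 0 < x t + e * f x.
  elim: l {hl hf} hl' => [|x l IHl] hl'; first by exists 1.
  have [|e [e0 he]] := IHl; first by move=> y yl; apply: hl'; rewrite inE yl orbT.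
  have [x0|nx0] := eqVneq (x t) 0.
    exists e; split => // y; rewrite inE => /orP[/eqP->|/he//].
    by rewrite x0 eqxx.
  have xt := hl' _ (mem_head _ _) nx0.
  have n0 : 0 < 1 + `|f x| by rewrite ltr_pwDl.
  pose e' := Num.min e (x t / (1 + `|f x|) / 2).
  have e'0 : 0 < e' by rewrite lt_min e0 /=; do 2 apply: divr_gt0 => //; lra.
  exists e'; split => // y; rewrite inE => /orP[/eqP->|yl] ny.
    have : e' * (1 + `|f x|) <= x t / 2.
      rewrite -ler_pdivlMr // mulrAC ge_min lexx orbT //.
    have : - e' * `|f x| <= e' * f x.
      by rewrite mulNr -mulrN ler_pM2l // lerNl -normrN ler_norm.
    nra.
  have := he y yl ny; have ty : 0 < y t by apply: hl' => //; rewrite inE yl orbT.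
  have : e' <= e by rewrite ge_min lexx.
  by have [fy|fy] := lerP 0 (f y); nra.
pose g (x : lc) := x t + e * f x.
have gB : zmod_morphism g by move=> x y; rewrite /g raddfB lcvalE /=; lra.
pose gm := GRing.isZmodMorphism.Build _ _ g gB.
pose G : {additive lc -> Rr} := HB.pack g gm.
exists G => x xl; rewrite /= /g; have [x0|] := eqVneq (x t) 0; last exact: he.
by rewrite x0 add0r mulr_gt0 // hf // mem_filter x0 eqxx.
Qed.

Lemma lc_functional (l : seq lc) : exists f : {additive lc -> Rr},
  forall x, x \in l -> (0 < x -> 0 < f x) /\ (0 <= x -> 0 <= f x).
Proof.
have [ts [sts hts]] : exists ts : seq rat, sorted <%O ts /\
    forall x, x \in [seq x : lc <- l | 0 < x] ->
      exists t, [/\ t \in ts, 0 < x t & forall s, s < t -> x s = 0].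
  elim: l => [|x l [ts [sts IH]]]; first by exists [::].
  have [x0|nx0] := boolP (0 < x); last first.
    by exists ts; split=> // y; rewrite /= (negbTE nx0); exact: IH.
  have [t [xt xs]] := (lcposE x).2 x0.
  have [u [su mu]] : exists u, sorted <%O u /\ forall r, (r \in u) = (r \in t :: ts).
    exists (sort <=%O (undup (t :: ts))); split; first by rewrite sort_lt_sorted undup_uniq.
    by move=> r; rewrite mem_sort mem_undup.
  exists u; split=> // y; rewrite /= x0 inE => /orP[/eqP->|/IH[s [sts' ys yl]]].
    by exists t; rewrite mu mem_head.
  by exists s; rewrite mu inE sts' orbT.
have [f hf] := lc_functional_leads sts hts.
exists f => x xl; have fpos : 0 < x -> 0 < f x.
  by move=> x0; apply: hf; rewrite mem_filter x0.
split => //; rewrite le_eqVlt => /orP[/eqP<-|/fpos/ltW//].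
by rewrite raddf0.
Qed.

(** Nested conjunctions, one per list entry, are what [lc_apply] consumes hypothesis by
    hypothesis. *)
Lemma lc_functional_foldr (l : seq lc) : exists f : {additive lc -> Rr},
  foldr (fun x P => ((0 < x -> 0 < f x) /\ (0 <= x -> 0 <= f x)) /\ P) True l.
Proof.
have [f hf] := lc_functional l; exists f.
elim: l hf => //= x l IH hf; split; first by apply: hf; rewrite mem_head.
by apply: IH => y yl; apply: hf; rewrite inE yl orbT.
Qed.

Lemma lc_le_sub (x y : lc) : x <= y -> 0 <= y - x.
Proof. by rewrite lc_subr_ge0. Qed.

Lemma lc_lt_sub (x y : lc) : x < y -> 0 < y - x.
Proof. by rewrite lc_subr_gt0. Qed.

(* [lra] needs an ordered field, while [lc] is only equipped with its group structure: [lc_lra] transports the hypotheses to the reals along an additive functional that preserves their signs. *)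
Ltac lc_revert := repeat match goal with
  | H : is_true (@Order.le _ _ ?x ?y) |- _ => generalize (@lc_le_sub x y H); clear H
  | H : is_true (@Order.lt _ _ ?x ?y) |- _ => generalize (@lc_lt_sub x y H); clear H
  end.

Ltac lc_terms g := lazymatch g with
  | is_true (@Order.le _ _ _ ?x) -> ?g' => let r := lc_terms g' in constr:((x : lc) :: r)
  | is_true (@Order.lt _ _ _ ?x) -> ?g' => let r := lc_terms g' in constr:((x : lc) :: r)
  | _ => constr:([::] : seq lc)
  end.

Ltac lc_apply := lazymatch goal with
  | |- ((_ -> _) /\ (_ -> _)) /\ _ -> is_true (@Order.le _ _ _ _) -> _ =>
      let hp := fresh in let hn := fresh in let h := fresh in let hs := fresh in
      intros [[hp hn] hs] h; pose proof (hn h); clear hp hn h; revert hs; lc_apply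
  | |- ((_ -> _) /\ (_ -> _)) /\ _ -> is_true (@Order.lt _ _ _ _) -> _ =>
      let hp := fresh in let hn := fresh in let h := fresh in let hs := fresh in
      intros [[hp hn] hs] h; pose proof (hp h); clear hp hn h; revert hs; lc_apply
  | |- True -> _ => intros _
  end.

Ltac lc_contra :=
  lc_revert;
  repeat match goal with H : ?P |- _ => match type of P with Prop => clear H end end;
  lazymatch goal with |- ?g =>
    let l := lc_terms g in let f := fresh "f" in let hf := fresh in
    destruct (lc_functional_foldr l) as [f hf];
    revert hf; cbn [foldr]; lc_apply; lra
  end.

Ltac lc_lra := lazymatch goal with
  | |- is_true (@Order.le _ _ _ _) =>
      rewrite leNgt; apply/negP; let H := fresh in intro H; lc_contra
  | |- is_true (@Order.lt _ _ _ _) =>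
      rewrite ltNge; apply/negP; let H := fresh in intro H; lc_contra
  | |- @eq bool _ _ => exfalso; lc_contra
  | |- @eq _ _ _ => apply/eqP; rewrite eq_le; apply/andP; split; lc_lra
  | |- False => lc_contra
  | _ => exfalso; lc_contra
  end.

Lemma lc_leD (x y z w : lc) : x <= y -> z <= w -> x + z <= y + w.
Proof. by move=> ? ?; lc_lra. Qed.

Lemma lc_le_sum (I : eqType) (s : seq I) (F G : I -> lc) :
  (forall i, i \in s -> F i <= G i) -> \sum_(i <- s) F i <= \sum_(i <- s) G i.
Proof.
elim: s => [|i s IH] h; first by rewrite !big_nil.
rewrite !big_cons; apply: lc_leD; first by apply: h; rewrite mem_head.
by apply: IH => j js; apply: h; rewrite inE js orbT.
Qed.

(** * Half-open intervals *)

(* A pair [p] stands for the half-open interval [p.1 <= x < p.2], empty when [p.2 <= p.1]. *)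
Definition hmem (p : lc * lc) (x : lc) := (p.1 <= x) && (x < p.2).
Definition hlen (p : lc * lc) : lc := if p.1 <= p.2 then p.2 - p.1 else 0.
Definition hcap (p q : lc * lc) : lc * lc := (Order.max p.1 q.1, Order.min p.2 q.2).
Definition hdisj (p q : lc * lc) := Order.min p.2 q.2 <= Order.max p.1 q.1.
(** The test matters: if [q.2 < q.1], the two pieces could overlap between [q.2] and [q.1]. *)
Definition hdiff (p q : lc * lc) : seq (lc * lc) :=
  if q.1 < q.2 then [:: (p.1, Order.min p.2 q.1); (Order.max p.1 q.2, p.2)] else [:: p].
Definition smem (s : seq (lc * lc)) (x : lc) := has (hmem^~ x) s.
Definition slen (s : seq (lc * lc)) : lc := \sum_(p <- s) hlen p.

Ltac no_if x := lazymatch x with context [if _ then _ else _] => fail | _ => idtac end.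
Ltac lc_cases := repeat match goal with
  | |- context [@Order.le _ _ ?x ?y] => no_if x; no_if y; case: (leP x y) => ?
  | |- context [@Order.lt _ _ ?x ?y] => no_if x; no_if y; case: (ltP x y) => ?
  end.

Lemma hlen_ge0 p : 0 <= hlen p.
Proof. by rewrite /hlen; case: (leP p.1 p.2) => // ?; lc_lra. Qed.

Lemma slen_ge0 s : 0 <= slen s.
Proof.
rewrite /slen; elim: s => [|p s IH]; rewrite ?big_nil ?big_cons //.
by have := hlen_ge0 p => ?; lc_lra.
Qed.

Lemma slen_cat s1 s2 : slen (s1 ++ s2) = slen s1 + slen s2.
Proof. exact: big_cat. Qed.

Lemma slen1 p : slen [:: p] = hlen p.
Proof. by rewrite /slen big_seq1. Qed.

Lemma hdisjC : symmetric hdisj.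
Proof. by move=> p q; rewrite /hdisj minC maxC. Qed.

Lemma hdisjP p q : reflect (forall x, hmem p x -> hmem q x -> False) (hdisj p q).
Proof.
apply: (iffP idP) => [h x /andP[h1 h2] /andP[h3 h4]|h].
  have : Order.min p.2 q.2 <= x by apply: le_trans h _; rewrite ge_max h1.
  by rewrite leNgt lt_min h2 h4.
rewrite /hdisj leNgt; apply/negP => lt.
have := h (Order.max p.1 q.1); rewrite /hmem !le_max !lexx orbT /=.
by move: lt; rewrite lt_min => /andP[-> ->]; apply.
Qed.

Lemma smem_hdiff p q x : smem (hdiff p q) x = hmem p x && ~~ hmem q x.
Proof.
case: p q => [a b] [c e]; rewrite /smem /hdiff /hmem /=.
case: (ltP c e) => /= ce; rewrite orbF ?lt_min ?ge_max; lc_cases => //=; lc_lra.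
Qed.

Lemma hlen_cut a b t : hlen (a, b) = hlen (a, Order.min b t) + hlen (Order.max a t, b).
Proof.
rewrite /hlen /= maxElt minElt.
case: (leP a b) => ?; case: (ltP b t) => ?; case: (ltP a t) => ?;
  try (exfalso; lc_lra); lc_cases; lc_lra.
Qed.

Lemma hlen_empty p : p.2 <= p.1 -> hlen p = 0.
Proof. by rewrite /hlen => h; case: leP => // h'; lc_lra. Qed.

Lemma hlen_hdiff p q : hlen p = hlen (hcap p q) + slen (hdiff p q).
Proof.
case: p q => [a b] [c e]; rewrite /slen /hdiff /=; case: (ltP c e) => /= ce.
  rewrite big_cons big_seq1 addrCA (hlen_cut a b c) (hlen_cut (Order.max a c) b e).
  by rewrite -maxA (max_r (ltW ce)).
rewrite big_seq1 [hlen (hcap _ _)]hlen_empty ?add0r // /hcap /=.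
by rewrite ge_min !le_max ce !orbT.
Qed.

(** If both are nonempty, [p'] lies entirely on one side of [p], so it meets [q] exactly where it
    meets one of the two pieces of [q] minus [p]. *)
Lemma hlen_hcap_hdiff p p' q : hdisj p p' ->
  hlen (hcap p' q) <= \sum_(r <- hdiff q p) hlen (hcap p' r).
Proof.
case: p p' q => [a b] [a' b'] [c e].
rewrite /hdiff /=; case: (ltP a b) => /= ab; last by rewrite big_seq1.
rewrite !big_cons big_nil /hdisj /= => h.
set u := hcap _ (c, Order.min e a); set v := hcap _ (Order.max c b, e).
have u0 := hlen_ge0 u; have v0 := hlen_ge0 v.
have [ab'|ab'] := leP b' a'.
  rewrite [hlen (hcap (a', b') (c, e))]hlen_empty; last by rewrite /= ge_min !le_max ab'.
  lc_lra.
have /orP[ba|ba] : (b' <= a) || (b <= a').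
  by move: h; rewrite ge_min !le_max [b <= a]leNgt ab [b' <= a']leNgt ab' orbF /= orbC.
- suff -> : hcap (a', b') (c, e) = u by lc_lra.
  by rewrite /u /hcap /= minCA (min_l ba) minC.
- suff -> : hcap (a', b') (c, e) = v by lc_lra.
  by rewrite /v /hcap /= maxCA (max_l ba) maxC.
Qed.

(** Induction with [q] varying: the head [p] takes its share of [q], and the other intervals meet
    [q] only in the pieces of [q] minus [p]. *)
Lemma sum_hlen_hcap s q : pairwise hdisj s -> \sum_(p <- s) hlen (hcap p q) <= hlen q.
Proof.
elim: s q => [|p s IH] q; first by rewrite big_nil hlen_ge0.
rewrite pairwise_cons big_cons => /andP[/allP ps dis].
have : \sum_(p' <- s) hlen (hcap p' q) <= \sum_(r <- hdiff q p) \sum_(p' <- s) hlen (hcap p' r).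
  by rewrite exchange_big /=; apply: lc_le_sum => p' /ps; exact: hlen_hcap_hdiff.
have : \sum_(r <- hdiff q p) \sum_(p' <- s) hlen (hcap p' r) <= slen (hdiff q p).
  by apply: lc_le_sum => r _; exact: IH.
have := hlen_hdiff q p; rewrite /hcap maxC minC => -> h1 h2.
by apply: lc_leD => //; apply: le_trans h2 h1.
Qed.

(** * Differences of finite lists of half-open intervals *)

Definition sdiff1 (s : seq (lc * lc)) q := flatten [seq hdiff p q | p <- s].
Definition sdiff (s t : seq (lc * lc)) := foldl sdiff1 s t.

Lemma smem_cat s t x : smem (s ++ t) x = smem s x || smem t x.
Proof. exact: has_cat. Qed.

Lemma smem_sdiff1 s q x : smem (sdiff1 s q) x = smem s x && ~~ hmem q x.
Proof.
elim: s => //= p s IH; rewrite /sdiff1 /= smem_cat smem_hdiff -/(sdiff1 s q) IH.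
by rewrite andb_orl.
Qed.

Lemma smem_sdiff s t x : smem (sdiff s t) x = smem s x && ~~ smem t x.
Proof.
rewrite /sdiff; elim: t s => [|q t IH] s /=; first by rewrite andbT.
by rewrite IH smem_sdiff1 -andbA negb_or.
Qed.

Lemma allrel_hdisjP s t :
  reflect (forall x, smem s x -> smem t x -> False) (allrel hdisj s t).
Proof.
apply: (iffP allrelP) => [h x /hasP[p ps px] /hasP[q qt]|h p q ps qt].
  exact: (elimT (hdisjP p q) (h p q ps qt)).
by apply/hdisjP => x px qx; apply: (h x); apply/hasP; [exists p|exists q].
Qed.

Lemma pairwise_sdiff s t : pairwise hdisj s -> pairwise hdisj (sdiff s t).
Proof.
rewrite /sdiff; elim: t s => //= q t IH s ds; apply: IH.
elim: s ds => //= p s IH /andP[ps ds]; rewrite /sdiff1 /= pairwise_cat -/(sdiff1 s q).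
rewrite IH // andbT; apply/andP; split.
  apply/allrel_hdisjP => x; rewrite smem_hdiff smem_sdiff1 => /andP[px _] /andP[sx _].
  by move/allP: ps; move/hasP: sx => [r /[swap] rx /[swap] h /h/hdisjP]; apply; eauto.
rewrite /hdiff; case: ifP => //= pq; rewrite !andbT /hdisj /=.
by rewrite !(ge_min, le_max) (ltW pq) !orbT.
Qed.

(** What is lost is the total length of the traces on [q], bounded by [sum_hlen_hcap]. *)
Lemma slen_sdiff1 s q : pairwise hdisj s -> slen s <= slen (sdiff1 s q) + hlen q.
Proof.
move=> ds; have := sum_hlen_hcap q ds.
have -> : slen s = \sum_(p <- s) hlen (hcap p q) + slen (sdiff1 s q).
  elim: s {ds} => [|p s IH]; first by rewrite /slen !big_nil addr0.
  rewrite /sdiff1 /= slen_cat -/(sdiff1 s q) [slen (p :: s)]big_cons -/(slen s) IH.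
  by rewrite big_cons (hlen_hdiff p q) addrACA.
by move=> h; rewrite addrC; exact: lc_leD.
Qed.

Lemma slen_sdiff s t : pairwise hdisj s -> slen s <= slen (sdiff s t) + slen t.
Proof.
elim: t s => [|q t IH] s ds; first by rewrite /slen big_nil addr0.
have h1 := slen_sdiff1 q ds; have h2 := IH _ (pairwise_sdiff [:: q] ds).
rewrite [slen (q :: t)]big_cons -/(slen t); move: h1 h2; rewrite /sdiff /= => *; lc_lra.
Qed.

(** * Convergence *)

(** The valuation of [x] exceeds [q]. The convergence defined from this is identified with order
    convergence in [conv_lim]. *)
Definition vanish q (x : lc) := forall t, t <= q -> x t = 0.
Definition psums (u : nat -> lc) n : lc := \sum_(i < n) u i.
Definition null (u : nat -> lc) :=
  forall q, exists N, forall n, (N <= n)%N -> vanish q (u n).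
Definition conv (u : nat -> lc) (L : lc) := null (fun n => u n - L).

Lemma psumsS u n : psums u n.+1 = psums u n + u n.
Proof. exact: big_ord_recr. Qed.

Lemma psums_mono u : (forall n, 0 <= u n) -> {homo psums u : m n / (m <= n)%N >-> m <= n}.
Proof.
move=> u0; apply: homo_leq => [//|y x z|n]; first exact: le_trans.
by rewrite psumsS; have := u0 n => ?; lc_lra.
Qed.

Lemma vanishD q x y : vanish q x -> vanish q y -> vanish q (x + y).
Proof. by move=> hx hy t tq; rewrite lcvalE hx // hy // addr0. Qed.

Lemma vanishN q x : vanish q x -> vanish q (- x).
Proof. by move=> hx t tq; rewrite lcvalE hx // oppr0. Qed.

Lemma vanish_slen q s : (forall p, p \in s -> vanish q (hlen p)) -> vanish q (slen s).
Proof.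
move=> h t tq; rewrite lcval_sum big_seq big1 // => p ps; exact: h.
Qed.

Lemma lc_lead_gt0 (x : lc) : 0 < x -> exists t, 0 < x t /\ forall s, s < t -> x s = 0.
Proof. by move/lcposE. Qed.

Lemma lt_vanish (x : lc) : 0 < x -> exists q, forall y, vanish q y -> y < x.
Proof.
move/lc_lead_gt0 => [q [xq x0]]; exists q => y hy.
rewrite -lc_subr_gt0 -lcposE; exists q; rewrite lcvalE hy // subr0.
by split => // s sq; rewrite lcvalE x0 // hy ?subrr // ltW.
Qed.

(** If the leading exponent of [x] were at most [q], [x] would dominate [y]. *)
Lemma vanish_squeeze q (x y : lc) : 0 <= x -> x <= y -> vanish q y -> vanish q x.
Proof.
rewrite le_eqVlt => /orP[/eqP<- //|/lc_lead_gt0[t [xt x0]]] xy hy.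
have [tq|qt] := leP t q; last by move=> s sq; apply: x0; apply: le_lt_trans sq qt.
suff : y < x by rewrite ltNge xy.
rewrite -lc_subr_gt0 -lcposE; exists t; rewrite lcvalE hy // subr0.
by split => // s st; rewrite lcvalE x0 // hy ?subrr // (le_trans (ltW st)).
Qed.

Lemma dq_gt0 q : 0 < dq q.
Proof.
rewrite -lcposE; exists q; rewrite monomialE eqxx ltr01; split => // s sq.
by rewrite monomialE lt_eqF.
Qed.

Lemma vanish_monomial r q t : q < t -> vanish q (monomial r t).
Proof. by move=> qt s sq; rewrite monomialE lt_eqF // (le_lt_trans sq). Qed.

Notation dn k := (dq k%:R).

Lemma rat_lt_nat (q : rat) : exists k : nat, q < k%:R.
Proof.
exists (Num.bound q); apply: le_lt_trans (ler_norm q) _.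
by have := archi_boundP (normr_ge0 q); rewrite /Num.bound normr_id.
Qed.

Lemma dn_small (x : lc) : 0 < x -> exists k : nat, dn k < x.
Proof.
move/lt_vanish => [q hq]; have [k qk] := rat_lt_nat q.
by exists k; apply: hq; exact: vanish_monomial.
Qed.

(** Serves to split an error [d^k] into several smaller ones. *)
Lemma dnD k m : (k < m)%N -> dn m + dn m < dn k.
Proof.
move=> km; rewrite -lc_subr_gt0 -lcposE; exists k%:R; split.
  by rewrite !lcvalE !monomialE eqxx lt_eqF ?ltr_nat //; lra.
move=> s sk; rewrite !lcvalE !monomialE !lt_eqF //; first lra.
by rewrite (lt_trans sk) // ltr_nat.
Qed.

Lemma lc_le_dn (x y : lc) : (forall k : nat, x <= y + dn k) -> x <= y.
Proof.
move=> h; rewrite leNgt; apply/negP; rewrite -lc_subr_gt0 => /dn_small[k hk].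
by have := h k => ?; lc_lra.
Qed.

Lemma nullP (u : nat -> lc) : (forall k : nat, exists N, forall n, (N <= n)%N -> - dn k <= u n <= dn k) -> null u.
Proof.
move=> h q; have [k qk] := rat_lt_nat q; have [N hN] := h k; exists N => n /hN/andP[h1 h2].
have hv : vanish q (dn k) by exact: vanish_monomial.
have [u0|u0] := leP (0 : lc) (u n); first exact: vanish_squeeze hv.
rewrite -[u n]opprK; apply: vanishN; apply: vanish_squeeze hv; lc_lra.
Qed.

Lemma conv_le u L M N : conv u L -> (forall n, (N <= n)%N -> u n <= M) -> L <= M.
Proof.
move=> cv h; rewrite leNgt; apply/negP; rewrite -lc_subr_gt0 => /lt_vanish[q hq].
have [N' hN'] := cv q; have h1 := h _ (leq_maxl N N').
by have h2 := hq _ (vanishN (hN' _ (leq_maxr N N'))); lc_lra.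
Qed.

Lemma conv_mono_le u L : (forall n, 0 <= u n) -> conv (psums u) L -> forall n, psums u n <= L.
Proof.
move=> u0 cv n; rewrite leNgt; apply/negP; rewrite -lc_subr_gt0 => /lt_vanish[q hq].
have [N hN] := cv q; have h1 := psums_mono u0 (leq_maxl n N).
by have h2 := hq _ (hN _ (leq_maxr n N)); lc_lra.
Qed.

(** The coefficient at [t] is constant from the index [N t] on, which defines the limit. As [N q]
    serves all [t <= q] at once, the limit agrees up to [q] with one partial sum, hence is
    left-finite. *)
Lemma null_psums_conv u : null u -> exists L, conv (psums u) L.
Proof.
move=> /choice[N hN].
have stat t q n : t <= q -> (N q <= n)%N -> psums u n t = psums u (N q) t.
  move=> tq /subnKC <-; elim: (n - N q)%N => [|k IH]; first by rewrite addn0.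
  by rewrite addnS psumsS lcvalE IH (hN q) ?addr0 // leq_addr.
pose L t := psums u (N t) t.
have LE t q n : t <= q -> (N q <= n)%N -> psums u n t = L t.
  move=> tq h; rewrite (stat _ _ _ tq h) -(stat _ _ _ tq (leq_maxl _ (N t))).
  by rewrite (stat t t) // leq_maxr.
have LCL : LC L.
  move=> q; have [s hs] := lcvalP (psums u (N q)) q.
  by exists s => t nz tq; apply: hs => //; rewrite (LE t q) // ltW.
exists (MkLC LCL) => q; exists (N q) => n hn t tq.
by rewrite lcvalE (LE t q n) // subrr.
Qed.

(* Otherwise, once finitely many of the [J n] are removed, some remaining interval [c, e) has a length of the order of [d ^ t], while the lengths of the remaining [J n] are infinitely smaller. The points [c + rho d ^ t], [rho] real, then lie in distinct [J n], although there are uncountably many of them. *)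
Lemma slen_le_cover s J b : pairwise hdisj s -> null (fun n => hlen (J n)) ->
  (forall n, psums (fun n => hlen (J n)) n <= b) ->
  (forall x, smem s x -> exists n, hmem (J n) x) -> slen s <= b.
Proof.
move=> ds nJ Jb cov; rewrite leNgt; apply/negP; rewrite -lc_subr_gt0 => /lt_vanish[q hq].
(* Whatever vanishes up to [q] is smaller than [slen s - b]; from [N] on this applies to the length
   of each [J n]. *)
have [N hN] := nJ q; pose s' := sdiff s (mkseq J N).
have ls' : slen s - b <= slen s'.
  have h1 := slen_sdiff (mkseq J N) ds; have := Jb N.
  have -> : psums (fun n => hlen (J n)) N = slen (mkseq J N).
    by rewrite /slen /mkseq big_map /psums -(big_mkord xpredT (fun n => hlen (J n))) /index_iota subn0.
  by rewrite /s' => ?; lc_lra.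
have [[c e] ps' npv] : exists2 p, p \in s' & ~ vanish q (hlen p).
  apply: contrapT => h; have : vanish q (slen s').
    by apply: vanish_slen => p ps'; apply: contrapT => h'; apply: h; exists p.
  by move/hq; rewrite ltNge ls'.
have ce : c < e by rewrite ltNge; apply/negP => h; apply: npv; rewrite hlen_empty.
move: npv; rewrite /hlen /= (ltW ce) => npv.
have [t [wt wl]] := lc_lead_gt0 (lc_lt_sub ce).
have tq : t <= q.
  by rewrite leNgt; apply/negP => qt; apply: npv => r rq; apply: wl; exact: le_lt_trans qt.
have mono_gt0 r : 0 < r -> 0 < monomial r t.
  move=> r0; rewrite -lcposE; exists t; rewrite monomialE eqxx; split => // r' r't.
  by rewrite monomialE lt_eqF.
have cov' r : 0 < r -> r < (e - c) t -> exists2 n, (N <= n)%N & hmem (J n) (c + monomial r t).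
  move=> r0 rw; have : smem s' (c + monomial r t).
    apply/hasP; exists (c, e) => //; rewrite /hmem /=.
    have h1 := mono_gt0 _ r0; apply/andP; split; first lc_lra.
    have : monomial r t < e - c.
      rewrite -lc_subr_gt0 -lcposE; exists t; rewrite lcvalB monomialE eqxx subr_gt0.
      by split => // r' r't; rewrite lcvalB wl // monomialE lt_eqF // subrr.
    by move=> h2; lc_lra.
  rewrite /s' smem_sdiff => /andP[/cov[n Jn] nJs]; exists n => //.
  rewrite leqNgt; apply: contra nJs => nN; apply/hasP; exists (J n) => //.
  by apply/mapP; exists n; rewrite // mem_iota.
(* Two such points with parameters [r < r'] in one [J n], [N <= n], would make its length at least
   [(r' - r) d^t], which does not vanish up to [q] as [t <= q]. An interval without such a point
   gets the dummy value 0. *)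
have [u hu] : exists u : nat -> Rr, forall n r, (N <= n)%N ->
    hmem (J n) (c + monomial r t) -> u n = r.
  suff /choice[u] : forall n, exists y, forall r, (N <= n)%N ->
      hmem (J n) (c + monomial r t) -> y = r by exists u.
  move=> n; have [[r Jr]|no] := pselect (exists r, hmem (J n) (c + monomial r t)); last first.
    by exists 0 => r _ Jr; case: no; exists r.
  exists r => r' /hN vn Jr'.
  wlog rr' : r r' Jr Jr' / r < r'.
    by move=> W; case: (ltgtP r r') => // h; [exact: W|symmetry; exact: W].
  have : monomial (r' - r) t <= hlen (J n).
    have -> : monomial (r' - r) t = monomial r' t - monomial r t.
      by apply: lc_inj => z; rewrite lcvalB !monomialE; case: eqP => _; rewrite ?subr0.
    move/andP: Jr => [h1 h2]; move/andP: Jr' => [h3 h4].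
    by rewrite /hlen; case: (leP (J n).1 _) => h; lc_lra.
  move=> /vanish_squeeze/(_ vn) h.
  have : monomial (r' - r) t t = 0 by apply: h => //; apply/ltW/mono_gt0; rewrite subr_gt0.
  by rewrite monomialE eqxx; lra.
(* Any closed interval inside the open range from 0 to the leading coefficient of [e - c] would
   do. *)
have [x [/andP[ax xb] hx]] : exists x, (e - c) t / 3 <= x <= (e - c) t / 2 /\ forall n, u n != x.
  by apply: real_interval_uncountable; lra.
have [||n Nn Jx] := cov' x; [lra|lra|].
by move/eqP: (hx n); apply; exact: hu Jx.
Qed.

(** * From lists of half-open intervals to families *)

Lemma psums_slen D n : psums (fun n => slen (D n)) n = slen (flatten (mkseq D n)).
Proof.
elim: n => [|n IH]; first by rewrite /psums big_ord0 /slen big_nil.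
by rewrite psumsS mkseqS flatten_rcons slen_cat IH.
Qed.

Lemma hmem_empty p x : p.2 <= p.1 -> hmem p x = false.
Proof. by move=> h; apply/andP => -[h1 h2]; lc_lra. Qed.

Lemma slen_empty s : (forall x, ~~ smem s x) -> slen s = 0.
Proof.
move=> h; rewrite /slen big_seq big1 // => p ps; apply: hlen_empty.
rewrite leNgt; apply/negP => lt; move/negP: (h p.1); apply; apply/hasP.
by exists p => //; rewrite /hmem lexx.
Qed.

Lemma slen_subset s t : pairwise hdisj s -> (forall x, smem s x -> smem t x) ->
  slen s <= slen t.
Proof.
move=> ds st; have := slen_sdiff t ds; rewrite (@slen_empty (sdiff s t)) ?add0r //.
by move=> x; rewrite smem_sdiff; apply/negP => /andP[/st->].
Qed.

(** Usual disjointification, with a fixed list [G] removed as well: [G] is empty when the K_n are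
    built, and consists of pieces already built when the rest S is covered. *)
Definition disjointed (G : seq (lc * lc)) (l : nat -> seq (lc * lc)) n :=
  sdiff (l n) (G ++ flatten (mkseq l n)).

Lemma smem_disjointed G l n x : smem (flatten (mkseq (disjointed G l) n)) x =
  smem (flatten (mkseq l n)) x && ~~ smem G x.
Proof.
elim: n => // n IH; rewrite !mkseqS !flatten_rcons !smem_cat IH smem_sdiff smem_cat.
by case: (smem _ x); case: (smem G x); rewrite /= ?andbT ?andbF.
Qed.

Lemma pairwise_disjointed G l n : (forall n, pairwise hdisj (l n)) ->
  pairwise hdisj (flatten (mkseq (disjointed G l) n)).
Proof.
move=> dl; elim: n => // n IH; rewrite mkseqS flatten_rcons pairwise_cat IH pairwise_sdiff //.
rewrite !andbT; apply/allrel_hdisjP => x; rewrite smem_disjointed => /andP[lx _].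
by rewrite smem_sdiff smem_cat lx orbT andbF.
Qed.

(* Each list is headed by an empty interval, so that the first [n] lists have at least [n] terms. *)
Lemma enum_lists (D : nat -> seq (lc * lc)) L :
  (forall n, pairwise hdisj (flatten (mkseq D n))) -> conv (psums (fun n => slen (D n))) L ->
  exists P : nat -> lc * lc, [/\ forall i j, i <> j -> hdisj (P i) (P j),
    forall x, (exists n, hmem (P n) x) <-> (exists n, smem (D n) x) &
    conv (psums (fun n => hlen (P n))) L].
Proof.
move=> dD cD; pose o : lc * lc := (0, 0).
have o0 x : hmem o x = false by apply: hmem_empty.
pose G n := flatten (mkseq (fun n => o :: D n) n).
have GS n : G n.+1 = G n ++ o :: D n by rewrite /G mkseqS flatten_rcons.
have sizeG n : (n <= size (G n))%N.
  by elim: n => // n IH; rewrite GS size_cat /= addnS ltnS (leq_trans IH) ?leq_addr.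
have prefG m k : exists r, G (m + k)%N = G m ++ r.
  elim: k => [|k [r IH]]; first by exists [::]; rewrite addn0 cats0.
  by exists (r ++ o :: D (m + k)%N); rewrite addnS GS IH catA.
have nthG (m m' i : nat) : (m <= m')%N -> (i < size (G m))%N -> nth o (G m') i = nth o (G m) i.
  by move=> /subnKC <- im; have [r ->] := prefG m (m' - m)%N; rewrite nth_cat im.
(* The list [G i.+1] has more than [i] entries, so the default is never reached. *)
pose P i := nth o (G i.+1) i.
have PG m i : (i < size (G m))%N -> P i = nth o (G m) i.
  move=> im; rewrite -(nthG _ _ _ (leq_maxl m i.+1)) // /P.
  by rewrite -(nthG _ _ _ (leq_maxr m i.+1)).
have memG n x : smem (G n) x = smem (flatten (mkseq D n)) x.
  elim: n => // n IH; rewrite GS mkseqS flatten_rcons !smem_cat IH.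
  by rewrite /smem /= o0.
have dG n : pairwise hdisj (G n).
  elim: n => // n IH; rewrite GS pairwise_cat IH /=.
  have := dD n.+1; rewrite mkseqS flatten_rcons pairwise_cat => /and3P[/allrel_hdisjP h _ ->].
  rewrite andbT; apply/andP; split; last first.
    by apply/allP => p _; apply/hdisjP => x; rewrite o0.
  apply/allrel_hdisjP => x; rewrite memG /smem /= o0; exact: h.
have lenG n : psums (fun i => hlen (P i)) (size (G n)) = psums (fun n => slen (D n)) n.
  transitivity (slen (G n)).
    rewrite /slen (big_nth o) big_mkord; apply: eq_bigr => i _.
    by rewrite (PG n).
  elim: n => [|n IH]; first by rewrite /slen big_nil /psums big_ord0.
  by rewrite GS slen_cat IH psumsS /slen big_cons hlen_empty // add0r.
exists P; split.
- move=> i j; wlog ij : i j / (i < j)%N.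
    move=> W; case: (ltngtP i j) => // h n; first exact: W.
    by rewrite hdisjC; apply: W => // /esym.
  move=> _; have /(pairwiseP o)/(_ i j) := dG j.+1.
  rewrite -!PG ?(leq_trans ij) ?(leq_trans (leqnSn _) (sizeG _)) //.
  by apply => //; rewrite inE ?(leq_trans ij) ?(leq_trans (leqnSn _) (sizeG _)).
- move=> x; split=> -[n nx].
    have : smem (G n.+1) x.
      by apply/hasP; exists (P n) => //; apply: mem_nth; exact: sizeG.
    rewrite memG => /hasP[p /flattenP[s /mapP[i _ ->] ps] px].
    by exists i; apply/hasP; exists p.
  have : smem (G n.+1) x by rewrite memG mkseqS flatten_rcons smem_cat nx orbT.
  move=> /(has_nthP o)[i iG ix]; exists i; by rewrite (PG n.+1).
(* Partial sums over single intervals are squeezed between the partial sums of list lengths at [N]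
   and at [n], the latter because [G n] has at least [n] entries. *)
- move=> q; have [N hN] := cD q; exists (maxn N (size (G N))) => n.
  rewrite geq_max => /andP[Nn Gn].
  have h1 : psums (fun n => slen (D n)) N <= psums (fun n => hlen (P n)) n.
    by rewrite -lenG; apply: psums_mono => // i; exact: hlen_ge0.
  have h2 : psums (fun n => hlen (P n)) n <= psums (fun n => slen (D n)) n.
    by rewrite -lenG; apply: psums_mono => // i; exact: hlen_ge0.
  set x := psums _ n in h1 h2 *; set y := psums _ N in h1.
  have -> : x - L = (x - y) + (y - L) by rewrite addrA subrK.
  apply: vanishD; last exact: hN.
  apply: (@vanish_squeeze q _ (psums (fun n => slen (D n)) n - y)); [lc_lra|lc_lra|].
  have -> : psums (fun n => slen (D n)) n - y =
      (psums (fun n => slen (D n)) n - L) - (y - L) by rewrite opprB addrA subrK.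
  by apply: vanishD; [exact: hN|apply: vanishN; exact: hN].
Qed.

(** Every positive element bounds all elements of large enough valuation; conversely the powers
    [d^k] serve as test values. *)
Lemma conv_lim u L : conv u L <-> lc_lim_to (fun n => lcval (u n)) L.
Proof.
split=> [cv|[_ lim]].
  split=> [|e he]; first exact: lcvalP.
  move=> /(lcposE (MkLC he))/lt_vanish[q hq]; have [N hN] := cv q; exists N => m /hN v.
  split; apply/(lcltE (_ - _) (MkLC he)); first exact: hq.
  by apply: hq; rewrite -opprB; exact: vanishN.
apply: nullP => k; have [] := lim (dn k) (lcvalP _).
  by apply/lcposE; exact: dq_gt0.
move=> N hN; exists N => n /hN[/(lcltE (u n - L)) h1 /(lcltE (L - u n)) h2].
by apply/andP; split; lc_lra.
Qed.

Lemma psum_hlen F P n : (forall n, fam_len F n = lcval (hlen (P n))) ->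
  psum (fam_len F) n = lcval (psums (fun n => hlen (P n)) n).
Proof.
move=> h; elim: n => [|n IH] /=; first by rewrite /psums big_ord0.
by rewrite psumsS IH h.
Qed.

Lemma fam_sum_conv F P L : (forall n, fam_len F n = lcval (hlen (P n))) ->
  fam_sum_to F (lcval L) <-> conv (psums (fun n => hlen (P n))) L.
Proof.
move=> h; rewrite conv_lim /fam_sum_to.
by have -> : psum (fam_len F) = fun n => lcval (psums (fun n => hlen (P n)) n)
  by apply/funext => n; exact: psum_hlen.
Qed.

(** Empty pairs become absent terms because [valid_itv] demands distinct ends in order. *)
Definition fam_of (P : nat -> lc * lc) : itv_family := fun n =>
  if (P n).1 < (P n).2 then Some (Itv (P n).1 (P n).2 CO) else None.

Lemma fam_of_SomeE P n I : fam_of P n = Some I -> I = Itv (P n).1 (P n).2 CO /\ (P n).1 < (P n).2.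
Proof. by rewrite /fam_of; case: ifP => // h [<-]. Qed.

Lemma fam_of_len P n : fam_len (fam_of P) n = lcval (hlen (P n)).
Proof.
rewrite /fam_len /fam_of; case: ltP => h; last by rewrite hlen_empty.
by rewrite /hlen ltW.
Qed.

Lemma in_itv_hmem (p : lc * lc) (x : lc) : Defs.in_itv (Itv p.1 p.2 CO) x <-> hmem p x.
Proof.
rewrite /Defs.in_itv /hmem /=; split=> [[_ [/lcleE-> /lcltE->]]//|/andP[/lcleE h1 /lcltE h2]].
by split => //; exact: lcvalP.
Qed.

Lemma fam_union_LC F x : fam_union F x -> LC x.
Proof. by move=> [n [I [_ []]]]. Qed.

Lemma fam_of_union P (x : lc) : fam_union (fam_of P) x <-> exists n, hmem (P n) x.
Proof.
split=> [[n [I [/fam_of_SomeE[-> _] /in_itv_hmem]]]|[n h]]; first by exists n.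
exists n, (Itv (P n).1 (P n).2 CO); split; last exact/in_itv_hmem.
by rewrite /fam_of; case: ltP => // h'; rewrite hmem_empty in h.
Qed.

Lemma fam_of_valid P : fam_valid (fam_of P).
Proof.
move=> n I /fam_of_SomeE[-> h]; split; first exact: lcvalP.
by split; [exact: lcvalP|exact/lcltE].
Qed.

Lemma fam_of_disjoint P : (forall i j, i <> j -> hdisj (P i) (P j)) -> fam_disjoint (fam_of P).
Proof.
move=> h m n I J x mn /fam_of_SomeE[-> _] /fam_of_SomeE[-> _] hm hn.
have hx : LC x by case: hm.
have /hdisjP/(_ (MkLC hx)) := h _ _ mn; apply; exact/in_itv_hmem.
Qed.

Lemma fam_of_lists (D : nat -> seq (lc * lc)) L :
  (forall n, pairwise hdisj (flatten (mkseq D n))) -> conv (psums (fun n => slen (D n))) L ->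
  exists K, [/\ fam_valid K, fam_disjoint K,
    forall x : lc, fam_union K x <-> exists n, smem (D n) x & fam_sum_to K L].
Proof.
move=> dD /(enum_lists dD)[P [dP uP cP]]; exists (fam_of P); split.
- exact: fam_of_valid.
- exact: fam_of_disjoint.
- by move=> x; rewrite fam_of_union.
- exact/(fam_sum_conv _ (fam_of_len P)).
Qed.

Definition toLC (x : LCfun) : lc := if pselect (LC x) is left h then MkLC h else 0.

Lemma toLCK x : LC x -> lcval (toLC x) = x.
Proof. by rewrite /toLC; case: pselect. Qed.

(** An absent term becomes a pair of length 0. The kind of the interval is forgotten, so [ends_in]
    needs strict inequalities and [in_ends] yields only weak ones. *)
Definition ends (F : itv_family) n : lc * lc :=
  if F n is Some J then (toLC (ilo J), toLC (ihi J)) else (0, 0).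

Lemma ends_len F n : fam_valid F -> fam_len F n = lcval (hlen (ends F n)).
Proof.
rewrite /fam_len /ends => /(_ n); case: (F n) => [I /(_ _ erefl)[h1 [h2 h3]]|_]; last first.
  by rewrite hlen_empty.
rewrite -(toLCK h1) -(toLCK h2) in h3; move/lcltE: h3 => h3.
by rewrite /hlen /= (ltW h3) /itv_len -{1}(toLCK h1) -{1}(toLCK h2).
Qed.

Lemma ends_in F n I x : fam_valid F -> F n = Some I ->
  (ends F n).1 < x -> x < (ends F n).2 -> Defs.in_itv I x.
Proof.
rewrite /ends => h In; rewrite In /=; have [h1 [h2 h3]] := h _ _ In.
move=> /lcltE; rewrite toLCK // => l1 /lcltE; rewrite toLCK // => l2.
split; first exact: lcvalP.
by case: (ikd I); split => //; left.
Qed.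

Lemma in_ends F n I (x : lc) : fam_valid F -> F n = Some I -> Defs.in_itv I x ->
  (ends F n).1 <= x <= (ends F n).2.
Proof.
rewrite /ends => h In; rewrite In /=; have [h1 [h2 h3]] := h _ _ In.
move=> [_ hx]; suff [/lcleE-> /lcleE->] : lcle (toLC (ilo I)) x /\ lcle x (toLC (ihi I)) by [].
rewrite !toLCK //; case: (ikd I) hx => -[l1 l2]; split => //; by left.
Qed.

(** * Approximation of interval families by half-open intervals *)

Lemma psums_dn k n : psums (fun i => dn (k.+1 + i)) n <= dn k.
Proof.
(* Keeping a remainder [d^(k + n)] makes the induction work. *)
suff : psums (fun i => dn (k.+1 + i)) n + dn (k + n) <= dn k.
  by have := dq_gt0 (k + n)%:R => *; lc_lra.
elim: n => [|n IH]; first by rewrite /psums big_ord0 addn0 add0r.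
have := @dnD (k + n) (k.+1 + n) (leqnn _); rewrite psumsS addnS -addSn => h; lc_lra.
Qed.

Lemma psums_leD u v w n : (forall n, u n <= v n + w n) -> psums u n <= psums v n + psums w n.
Proof.
move=> h; elim: n => [|n IH]; first by rewrite /psums !big_ord0 addr0.
by rewrite !psumsS; have := h n => h1; lc_lra.
Qed.

(** Truncating the family costs less than [d^(k+1)]. Moving the n-th left end right by [d^(k+2+n)]
    puts the half-open interval inside the original one, whatever its kind, and costs at most
    [d^(k+1)] in total. *)
Lemma inner_approx A (s : lc) k : inner_sum A s -> exists l, [/\ pairwise hdisj l,
  forall x : lc, smem l x -> A x & s <= slen l + dn k].
Proof.
move=> [F [vF [dF [FA sF]]]]; pose P := ends F.
move: sF; rewrite (fam_sum_conv _ (fun n => ends_len n vF)) => cv.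
have [q hq] := lt_vanish (dq_gt0 k.+1%:R).
have [N hN] := cv q; have := hq _ (vanishN (hN _ (leqnn N))); rewrite opprB => sN.
pose Q n := ((P n).1 + dn (k.+2 + n), (P n).2).
have QF n (x : lc) : hmem (Q n) x -> exists2 I, F n = Some I & Defs.in_itv I x.
  have := dq_gt0 (k.+2 + n)%:R => e0; move=> /andP[/= h1 h2].
  case E : (F n) => [I|]; last by move: h1 h2; rewrite /P /ends E /= => *; lc_lra.
  by exists I => //; apply: (ends_in vF E) => //; lc_lra.
exists (mkseq Q N); split.
- apply/(pairwiseP (0, 0)) => i j; rewrite !inE size_mkseq => iN jN ij.
  rewrite !nth_mkseq //; apply/hdisjP => x /QF[I Ii xI] /QF[J Jj xJ].
  by apply: (dF i j I J x) => // eij; rewrite eij ltnn in ij.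
- by move=> x /hasP[p /mapP[i _ ->] /QF[I Ii xI]]; apply: FA; exists i, I.
- have -> : slen (mkseq Q N) = psums (fun n => hlen (Q n)) N.
    by rewrite /slen /mkseq big_map /psums -(big_mkord xpredT (fun n => hlen (Q n))) /index_iota subn0.
  have h1 := psums_dn k.+1 N.
  have h2 : psums (fun n => hlen (P n)) N <=
      psums (fun n => hlen (Q n)) N + psums (fun i => dn (k.+2 + i)) N.
    apply: psums_leD => n; have := dq_gt0 (k.+2 + n)%:R => e0.
    by rewrite /hlen /=; case: (leP (P n).1 _) => ?; case: (leP ((P n).1 + _) _) => ?; lc_lra.
  by have := @dnD k k.+1 (leqnn _) => h3; rewrite /P in h2; lc_lra.
Qed.

(** Weaker than an outer sum: overlaps are allowed, since enlarging intervals may create them, and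
    [b] only bounds the partial sums. *)
Definition covered (B : lc -> Prop) (b : lc) := exists J, [/\ null (fun n => hlen (J n)),
  forall n, psums (fun n => hlen (J n)) n <= b & forall x, B x -> exists n, hmem (J n) x].

Lemma conv_null u L : conv (psums u) L -> null u.
Proof.
move=> cv q; have [N hN] := cv q; exists N => n Nn.
have -> : u n = (psums u n.+1 - L) - (psums u n - L).
  by rewrite psumsS opprB addrA subrK addrC addKr.
by apply: vanishD; [|apply: vanishN]; apply: hN => //; exact: leqW.
Qed.

(** Moving the n-th right end by [d^(k+1+n)] captures a possible closed end, at a total cost of at
    most [d^k]. *)
Lemma outer_covered A (s : lc) k : outer_sum A s -> covered (fun x => A x) (s + dn k).
Proof.
move=> [F [vF [dF [AF sF]]]]; pose P := ends F.
move: sF; rewrite (fam_sum_conv _ (fun n => ends_len n vF)) -/P => cv.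
pose e n := dn (k.+1 + n); have e0 n : 0 < e n by exact: dq_gt0.
pose Q n := ((P n).1, (P n).2 + e n).
have P12 n : (P n).1 <= (P n).2.
  rewrite /P /ends; case E : (F n) => [I|] //=; have [h1 [h2 h3]] := vF _ _ E.
  by rewrite -(toLCK h1) -(toLCK h2) in h3; exact/ltW/lcltE.
have QP n : hlen (Q n) = hlen (P n) + e n.
  have := P12 n; have := e0 n => h1 h2.
  by rewrite /hlen /= h2; case: (leP (P n).1 _) => ?; lc_lra.
have nl : null e.
  move=> q; have [m qm] := rat_lt_nat q; exists m => n mn; apply: vanish_monomial.
  by apply: lt_le_trans qm _; rewrite ler_nat (leq_trans mn) // leq_addl.
exists Q; split.
- move=> q; have [N hN] := conv_null cv q; have [N' hN'] := nl q; exists (maxn N N') => n.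
  by rewrite geq_max => /andP[h1 h2]; rewrite QP; apply: vanishD; [exact: hN|exact: hN'].
- move=> n; have h1 := conv_mono_le (fun n => hlen_ge0 (P n)) cv n.
  have h2 := psums_dn k n; rewrite -/e in h2.
  have h3 : psums (fun n => hlen (Q n)) n <= psums (fun n => hlen (P n)) n + psums e n.
    by apply: psums_leD => m; rewrite QP.
  by lc_lra.
- move=> x /AF[n [I [In /(in_ends vF In)/andP[h1 h2]]]]; exists n.
  have {}h2 : x <= (P n).2 := h2.
  by rewrite /hmem /= h1 /=; have := e0 n => ?; lc_lra.
Qed.

(** * Comparison of inner and outer sums, and a criterion for S-measurability *)

Lemma slen_le_covered s b : pairwise hdisj s -> covered (smem s) b -> slen s <= b.
Proof. by move=> ds [J [nJ Jb cov]]; exact: slen_le_cover cov. Qed.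

Lemma covered_sub (B C : lc -> Prop) b : (forall x, B x -> C x) -> covered C b -> covered B b.
Proof. by move=> BC [J [nJ Jb cov]]; exists J; split => // x /BC/cov. Qed.

Lemma inner_le_covered A (s b : lc) : inner_sum A s -> covered (fun x => A x) b -> s <= b.
Proof.
move=> hs cb; apply: lc_le_dn => k; have [l [dl lA sl]] := inner_approx k hs.
by have := slen_le_covered dl (covered_sub lA cb) => h; lc_lra.
Qed.

Lemma inner_le_outer A (s s' : lc) : inner_sum A s -> outer_sum A s' -> s <= s'.
Proof.
by move=> hs hs'; apply: lc_le_dn => k; exact: inner_le_covered (outer_covered k hs').
Qed.

Lemma inner_sum_LC A s : inner_sum A s -> LC s.
Proof. by move=> [F [_ [_ [_ []]]]]. Qed.

Lemma outer_sum_LC A s : outer_sum A s -> LC s.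
Proof. by move=> [F [_ [_ [_ []]]]]. Qed.

(** As [L] is itself an inner sum, it is the supremum once no inner sum exceeds it, and this follows
    from outer sums arbitrarily close to [L]. It is applied to A, and to S with [L] equal to 0. *)
Lemma Smeasure_of A (L : lc) : inner_sum A L ->
  (forall k : nat, exists s : lc, outer_sum A s /\ s <= L + dn k) ->
  Smeasurable A /\ Smeasure_is A L.
Proof.
move=> iL ou; split.
  move=> e he /(lcposE (MkLC he))/dn_small[k hk]; have [s [os sL]] := ou k.
  exists L, s; split => //; split => //; apply/(lcleE (s - L) (MkLC he)); lc_lra.
split; split; [exact: lcvalP| |exact: lcvalP|]; split.
- move=> s hs; have Ls := inner_sum_LC hs; apply/(lcleE (MkLC Ls)).
  apply: lc_le_dn => k; have [s' [os h2]] := ou k; apply: le_trans h2.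
  exact: (@inner_le_outer A (MkLC Ls) s' hs os).
- by move=> u _; apply.
- move=> s hs; have Ls := outer_sum_LC hs; apply/(lcleE L (MkLC Ls)).
  exact: (@inner_le_outer A L (MkLC Ls) iL hs).
- move=> u hu h; apply/(lcleE (MkLC hu)); apply: lc_le_dn => k.
  by have [s [/h/(lcleE (MkLC hu)) h1 h2]] := ou k; exact: le_trans h2.
Qed.

Lemma inner_sum0 A : inner_sum A lc0.
Proof.
exists (fun=> None); do 3 split => //; first by move=> x [n [I []]].
split; first exact: LC0.
move=> e he ep; exists 0%N => m _.
have -> : psum (fam_len (fun=> None)) m = lcval 0.
  by elim: m => //= m ->; apply/funext => t; rewrite /lcadd addr0.
by split; apply/(lcltE (0 - 0) (MkLC he)); rewrite subrr; apply/(lcposE (MkLC he)).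
Qed.

Lemma Smeasurable_approx A k : Smeasurable A -> exists (l : seq (lc * lc)) (b : lc),
  [/\ pairwise hdisj l, forall x : lc, smem l x -> A x,
      covered (fun x => A x) b & b <= slen l + dn k].
Proof.
(* Three errors [d^(k+2)] add up: the gap, the inner and the outer approximation. *)
move=> hA; have [|sI [sJ [hI [hJ]]]] := hA (dn k.+2) (lcvalP _).
  by apply/lcposE; exact: dq_gt0.
have LI := inner_sum_LC hI; have LJ := outer_sum_LC hJ.
move=> /(lcleE (MkLC LJ - MkLC LI)) h1.
have [l [dl lA sl]] := @inner_approx A (MkLC LI) k.+2 hI.
have cov := @outer_covered A (MkLC LJ) k.+2 hJ.
exists l, (MkLC LJ + dn k.+2); split => //.
have := @dnD k.+1 k.+2 (leqnn _); have := @dnD k k.+1 (leqnn _); have := dq_gt0 k.+1%:R => *.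
lc_lra.
Qed.

(** * The decomposition of an S-measurable set *)

Theorem theorem2p1 (A : LCfun -> Prop) :
  (forall x, A x -> LC x) ->
  Smeasurable A ->
  exists (K : itv_family) (S : LCfun -> Prop) (L : LCfun),
    fam_valid K /\ fam_disjoint K /\
    (forall x, A x <-> (fam_union K x \/ S x)) /\
    (forall x, fam_union K x -> S x -> False) /\
    fam_sum_to K L /\ Smeasure_is A L /\
    Smeasurable S /\ Smeasure_is S lc0.
Proof.
move=> ALC mA.
have /choice[l /choice[b hlb]] := fun k => Smeasurable_approx k mA.
have dl k : pairwise hdisj (l k) by case: (hlb k).
have lA k (x : lc) : smem (l k) x -> A x by case: (hlb k) => _ h _ _; exact: h.
have cb k : covered (fun x => A x) (b k) by case: (hlb k).
have bl k : b k <= slen (l k) + dn k by case: (hlb k).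
pose D := disjointed [::] l; pose G n := flatten (mkseq D n).
have dG n : pairwise hdisj (G n) by exact: pairwise_disjointed.
have memG n x : smem (G n) x = smem (flatten (mkseq l n)) x.
  by rewrite /G smem_disjointed andbT.
have GA n (x : lc) : smem (G n) x -> A x.
  rewrite memG => /hasP[p /flattenP[s /mapP[i _ ->] ps] px]; apply: (lA i).
  by apply/hasP; exists p.
have Gb n k : slen (G n) <= b k.
  by apply: slen_le_covered => //; apply: covered_sub (cb k) => x; exact: GA.
have lG n : slen (l n) <= slen (G n.+1).
  by apply: slen_subset => // x lx; rewrite memG mkseqS flatten_rcons smem_cat lx orbT.
pose T := psums (fun n => slen (D n)).
have TG n : T n = slen (G n) by exact: psums_slen.
have D0 n : 0 <= slen (D n) by exact: slen_ge0.
(* For [n > k] the total up to stage [n] is at most [b k], while the total up to stage [k] is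
   already at least [b k - d^k]; so the stage [n] adds at most [d^k]. *)
have nD : null (fun n => slen (D n)).
  apply: nullP => k; exists k.+1 => n kn.
  have h1 := D0 n; have h2 := dq_gt0 k%:R; have h3 := Gb n.+1 k; have h4 := lG k; have h5 := bl k.
  have h6 : T k.+1 <= T n by exact: psums_mono.
  have h7 : T n.+1 = T n + slen (D n) by exact: psumsS.
  by rewrite -TG h7 in h3; rewrite -TG in h4; apply/andP; split; lc_lra.
have [L cL] := null_psums_conv nD.
have TL n : slen (G n) <= L by rewrite -TG; exact: conv_mono_le.
have bL k : b k <= L + dn k.
  by have h1 := bl k; have h2 := lG k; have h3 := TL k.+1; lc_lra.
have [K [vK dK uK sK]] := fam_of_lists dG cL.
have KA x : fam_union K x -> A x.
  move=> Kx; have hx := fam_union_LC Kx.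
  have [n nx] := (uK (MkLC hx)).1 Kx; apply: (GA n.+1 (MkLC hx)).
  by rewrite /G mkseqS flatten_rcons smem_cat nx orbT.
pose S x := A x /\ ~ fam_union K x.
have [_ mAL] : Smeasurable A /\ Smeasure_is A L.
  apply: Smeasure_of; first by exists K.
  move=> k; have [|sI [sJ [hI [hJ]]]] := mA (dn k) (lcvalP _).
    by apply/lcposE; exact: dq_gt0.
  have LI := inner_sum_LC hI; have LJ := outer_sum_LC hJ.
  move=> /(lcleE (MkLC LJ - MkLC LI)) h1; exists (MkLC LJ); split => //.
  (* Every inner sum is below each [b j], hence below [L + d^j] for all [j]. *)
  have : MkLC LI <= L.
    apply: lc_le_dn => j; apply: le_trans (bL j); exact: inner_le_covered (cb j).
  by move=> h2; lc_lra.
have [mS mS0] : Smeasurable S /\ Smeasure_is S (lcval 0).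
  apply: Smeasure_of; first exact: inner_sum0.
  move=> k; have [J [nJ Jb covJ]] := cb k.
  (* The [J n] are made disjoint and lose the pieces of [G k.+1], the first such list that includes
     stage [k]. *)
  pose l' n := [:: J n]; pose D' := disjointed (G k.+1) l'.
  have dl' n : pairwise hdisj (l' n) by [].
  have dD' n : pairwise hdisj (flatten (mkseq D' n)) by exact: pairwise_disjointed.
  have D'0 n : 0 <= slen (D' n) by exact: slen_ge0.
  have nD' : null (fun n => slen (D' n)).
    move=> q; have [N hN] := nJ q; exists N => n /hN; apply: vanish_squeeze => //.
    rewrite -slen1; apply: slen_subset; first exact: pairwise_sdiff.
    by move=> x; rewrite smem_sdiff => /andP[].
  have [L' cL'] := null_psums_conv nD'.
  have [K' [vK' dK' uK' sK']] := fam_of_lists dD' cL'.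
  exists L'; split; last first.
    apply: (conv_le (N := 0) cL') => n _; rewrite psums_slen add0r.
    (* The removed pieces and the remainders form one disjoint list still covered by the [J n]. As
       [G k.+1] uses up all of [b k] except at most [d^k], only [d^k] is left for the remainders. *)
    have : slen (G k.+1 ++ flatten (mkseq D' n)) <= b k.
      apply: (slen_le_cover _ nJ Jb).
        rewrite pairwise_cat dG dD' !andbT; apply/allrel_hdisjP => x Gx.
        by rewrite smem_disjointed Gx andbF.
      move=> x; rewrite smem_cat => /orP[/GA/covJ //|].
      rewrite smem_disjointed => /andP[/hasP[p /flattenP[s /mapP[i _ ->]]]].
      by rewrite inE => /eqP-> Jx _; exists i.
    rewrite slen_cat; have h1 := bl k; have h2 := lG k => h3; lc_lra.
  exists K'; split => //; split => //; split => // x [Ax nKx].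
  have hx := ALC x Ax; apply/(uK' (MkLC hx)).
  have [n Jn] := covJ (MkLC hx) Ax.
  have : smem (flatten (mkseq D' n.+1)) (MkLC hx).
    (* A point of S lies in some [J n], and outside [G k.+1], whose pieces belong to the union of
       [K]. *)
    rewrite smem_disjointed mkseqS flatten_rcons smem_cat {2}/smem /= Jn orbT /=.
    apply/negP => /hasP[p /flattenP[s /mapP[i _ ->] ps] px]; apply: nKx.
    by apply/(uK (MkLC hx)); exists i; apply/hasP; exists p.
  move=> /hasP[p /flattenP[s /mapP[i _ ->] ps] px].
  by exists i; apply/hasP; exists p.
exists K, S, L; do ?split => //.
- move=> Ax; have [Kx|nKx] := pselect (fam_union K x); [by left|by right].
- by move=> [/KA|[]].
- by move=> x Kx [_].
Qed.
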